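(* Let $s$ be a finite dataset, $n=|s|$, let $G(\theta,s)=\frac1n\sum_{z\in s}G(\theta,z)$ with $G(\cdot,z)$ $\mathcal{H}(\Psi)$-smooth in $\theta$ for all $z\in\mathcal{Z}$, and apply generalized SGD with mini-batches $s_k\subseteq s$ of size $m=|s_k|$. Let $M$ be the gradient correlation factor and $R_G(s,m)$ the model capacity risk. Then: (1) With learning rate $1$, the number of iterations $T$ required to achieve $$\max_{s_k\subseteq s}\Psi^*(\nabla_\theta G(\theta_k,s_k))\le\Psi^*(\varepsilon)$$ is $\mathcal{O}\!\left(\frac{n}{m\Psi^*(\varepsilon)-(n-m)M}\right)$, provided $m\Psi^*(\varepsilon)>(n-m)M$. (2) Assume $G(\theta,z)$ is both $\mathcal{H}(\psi)$-convex and $\mathcal{H}(\Psi)$-smooth in $\theta$. With learning rate $1$, the number of iterations required to satisfy $$G(\theta,s)-G(s)_*\le\psi^*(\varepsilon)-R_G(s,m)$$ is $\mathcal{O}\!\left(\frac{n}{m\Psi^*(\varepsilon)-(n-m)M}\right)$, provided $m\Psi^*(\varepsilon)>(n-m)M$. (3) Assume $G(\theta,s_k)$ is both $\mathcal{H}(\psi)$-convex and $\mathcal{H}(\Psi)$-smooth in $\theta$, where $\Psi^*(\mu)\ge t\psi^*(\mu)+b$ for all $\mu$, with $0<t<1$ and $b\in\mathbb{R}$. With learning rate $1$, the number of iterations required to reach $$\mathbb{E}_{s_k}G(\theta_k,s)-G(s)_*\le\psi^*(\varepsilon)-R_G(s,m)-\frac{b}{t}-\frac{n-m}{tm}M$$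 is bounded by $T=\mathcal{O}\!\left(\kappa\log\frac{1}{\psi^*(\varepsilon)-\psi^*(0)}\right)$, where $\kappa=-1/\log(1-mt/n)$, which is well defined since $0<mt/n<1$.
   Context: At any point where a function is not differentiable its gradient is set to $\mathbf{0}$ by convention. Energy function: a function $\Psi$ from a Euclidean space to $\mathbb{R}$ that is a Legendre function (proper, lower semicontinuous, convex, essentially smooth and essentially strictly convex), whose unique minimum is attained at the origin, and which has the radial form $\Psi(\mu)=\Psi_\circ(\|\mu\|)$ for some norm. $\Psi^*(\nu)=\sup_\mu\{\langle\mu,\nu\rangle-\Psi(\mu)\}$ is its convex conjugate. With $S_G(\mu,\nu)=G(\mu)-G(\nu)-\langle\nabla G(\nu),\mu-\nu\rangle$, a function $G$ is $\mathcal{H}(\Psi)$-smooth if $\Psi$ is an energy function and $S_G(\mu,\nu)\le\Psi(\mu-\nu)$ for all $\mu,\nu$, and $\mathcal{H}(\psi)$-convex if $\psi$ is an energy function and $S_G(\mu,\nu)\ge\psi(\mu-\nu)$ for all $\mu,\nu$. For a finite set $s'$ of data points from $\mathcal{Z}$, $G(\theta,s')=\frac{1}{|s'|}\sum_{z\in s'}G(\theta,z)$ and $G(s')_*=\min_\theta G(\theta,s')$. Generalized SGD with step size $\alpha$: $\theta_{k+1}=\theta_k-\alpha\nabla\Psi^*(\nabla_\theta G(\theta_k,s_k))$, where $s_k\subseteq s$ is the randomly sampled mini-batch at iteration $k$, $|s_k|=m$. Gradient correlation factor: $M=\max_{k,s_k}\big[G(\theta_{k+1},s\setminus s_k)-G(\theta_k,s\setminus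 s_k)\big]$, over iterations $k$ and mini-batches $s_k$. Model capacity risk: $R_G(s,m)=G(s)_*-\mathbb{E}[G(s^m)_*]$, where $s^m$ is a batch of size $m$ randomly sampled from $s$. $\varepsilon$ is a tolerance vector in parameter space; $\mathbb{E}_{s_k}$ is expectation over the random mini-batch. ''The number of iterations required is $\mathcal{O}(\cdot)$'' means the criterion holds at some iterate among the first $T$, with $T$ of the stated order and hidden constant depending on the initial point (through the initial suboptimality) but not on $\varepsilon$.
   Formalization: Repairs: mini-batch gradient = mean of per-sample gradients, in the interior of dom Ψ*; (1)'s max criterion and (2) are for runs whose sampled batch violates the criterion whenever some batch does; in (2) Ψ, ψ share one norm; in (3) the M term has a plus sign (minus only if M ≤ 0). *)

(* Defs.v *)
(* MathComp / MathComp-Analysis.                                              *)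
From HB Require Import structures.
From mathcomp Require Import all_boot all_order all_algebra.
From mathcomp Require Import all_classical all_reals all_analysis.

Set Implicit Arguments.
Unset Strict Implicit.
Unset Printing Implicit Defensive.

Import Order.TTheory GRing.Theory Num.Theory.
Import numFieldNormedType.Exports.

Local Open Scope classical_set_scope.
Local Open Scope ring_scope.

Section ConvexAnalysis.
Variables (R : realType) (d : nat).
Local Notation V := 'rV[R]_d.
Implicit Types (f : V -> \bar R) (h : V -> R) (Psi : V -> R).

Definition dot (u v : V) : R := \sum_i u 0 i * v 0 i.

(* The gradient is 0, by convention, wherever h is not differentiable. *)
Definition grad h (x : V) : V :=
  if `[< differentiable h x >] then \row_i 'D_('e_i) h x else 0.

Definition edifferentiable f (x : V) : Prop :=
  (\forall y \near x, f y \is a fin_num) /\ differentiable (fine \o f) x.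

Definition egrad f (x : V) : V :=
  if `[< edifferentiable f x >] then grad (fine \o f) x else 0.

Definition edom f : set V := [set x | f x < +oo]%E.

Definition eproper f : Prop := (forall x, f x != -oo%E) /\ edom f !=set0.

Definition econvex f : Prop := forall (x y : V) (t : R), 0 <= t <= 1 ->
  (f (t *: x + (1 - t) *: y)%R <= t%:E * f x + (1 - t)%R%:E * f y)%E.

(* Essential smoothness and essential strict convexity in the sense of
   Rockafellar, Convex Analysis, Section 26. *)
Definition essentially_smooth f : Prop :=
  [/\ (edom f)° !=set0,
      forall x, (edom f)° x -> edifferentiable f x
    & forall (u : nat -> V) (x : V), (forall i, (edom f)° (u i)) ->
        u @ \oo --> x -> ~ (edom f)° x ->
        (fun i => `|egrad f (u i)|) @ \oo --> +oo].

Definition dom_subdifferential f : set V :=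
  [set x | exists v : V, forall y, (f x + (dot v (y - x)%R)%:E <= f y)%E].

Definition essentially_strictly_convex f : Prop :=
  forall C : set V, convex_set (C : set (convex_lmodType V)) ->
    C `<=` dom_subdifferential f ->
    forall (x y : V) (t : R), C x -> C y -> x != y -> 0 < t < 1 ->
      (f (t *: x + (1 - t) *: y)%R < t%:E * f x + (1 - t)%R%:E * f y)%E.

Definition legendre f : Prop :=
  [/\ eproper f, lower_semicontinuous f, econvex f,
      essentially_smooth f & essentially_strictly_convex f].

Definition is_norm (N : V -> R) : Prop :=
  [/\ forall x, 0 <= N x,
      forall x, N x = 0 -> x = 0,
      forall (a : R) x, N (a *: x) = `|a| * N x
    & forall x y, N (x + y) <= N x + N y].

Definition radial (N : V -> R) Psi : Prop :=
  is_norm N /\ exists Psi0 : R -> R, forall x, Psi x = Psi0 (N x).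

Definition energy Psi : Prop :=
  [/\ legendre (fun x => (Psi x)%:E),
      forall x, x != 0 -> Psi 0 < Psi x
    & exists N, radial N Psi].

Definition conjugate Psi (nu : V) : \bar R :=
  ereal_sup [set (dot mu nu - Psi mu)%:E | mu in [set: V]].

(* The gradient field of h is a separate argument dh, because the gradient of a
   mini-batch average is fixed below as the average of the gradients. *)
Definition bregman h (dh : V -> V) (mu nu : V) : R :=
  h mu - h nu - dot (dh nu) (mu - nu).

Definition H_smooth Psi h (dh : V -> V) : Prop :=
  energy Psi /\ forall mu nu, bregman h dh mu nu <= Psi (mu - nu).

Definition H_convex psi h (dh : V -> V) : Prop :=
  energy psi /\ forall mu nu, psi (mu - nu) <= bregman h dh mu nu.

End ConvexAnalysis.

(* A dataset is a family s : 'I_n -> Z; a subset of it is given by its set of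
   indices. *)
Section SGD.
Variables (R : realType) (d n : nat) (Z : Type).
Local Notation V := 'rV[R]_d.
Variables (G : Z -> V -> R) (s : 'I_n -> Z).
Implicit Types (B : {set 'I_n}) (theta : V).

Definition Gavg B theta : R := #|B|%:R^-1 * \sum_(i in B) G (s i) theta.

(* Average of the per-sample gradients; it is the gradient of Gavg B wherever
   the summands are differentiable. *)
Definition dGavg B theta : V :=
  #|B|%:R^-1 *: \sum_(i in B) grad (G (s i)) theta.

(* The value of min_theta G(theta, B) when the minimum is attained. *)
Definition Gstar B : R := inf (range (Gavg B)).

Variables (m : nat) (Psi : V -> R).

(* theta_k for the mini-batches bs 0, ..., bs (k - 1) and step size alpha. *)
Fixpoint iterate (alpha : R) (theta0 : V) (bs : nat -> {set 'I_n}) (k : nat) : V :=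
  if k is k'.+1 then
    let theta := iterate alpha theta0 bs k' in
    theta - alpha *: egrad (conjugate Psi) (dGavg (bs k') theta)
  else theta0.

Definition run (bs : nat -> {set 'I_n}) : Prop := forall k, #|bs k| = m.

(* The supremum ranges over the iterations and over every realisation of the
   mini-batches, since theta_k depends on the earlier ones. *)
Definition correlation_factor (alpha : R) (theta0 : V) : \bar R :=
  ereal_sup [set x | exists bs k, run bs /\
    x = (Gavg (~: bs k) (iterate alpha theta0 bs k.+1)
         - Gavg (~: bs k) (iterate alpha theta0 bs k))%:E].

(* Expectation over one batch, uniform among the subsets of size m. *)
Definition Ebatch (F : {set 'I_n} -> R) : R :=
  'C(n, m)%:R^-1 * \sum_(B : {set 'I_n} | #|B| == m) F B.

(* E[F theta_k] for k independent uniform mini-batches of size m. *)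
Definition Eiterate (alpha : R) (theta0 : V) (k : nat) (F : V -> R) : R :=
  ('C(n, m) ^ k)%:R^-1 *
  \sum_(w : k.-tuple {set 'I_n} | all (fun B : {set 'I_n} => #|B| == m) w)
     F (iterate alpha theta0 (nth finset.set0 w) k).

Definition model_capacity_risk : R := Gstar [set: 'I_n]%SET - Ebatch Gstar.

Definition max_criterion (eps theta : V) : Prop :=
  forall B, #|B| = m ->
    (conjugate Psi (dGavg B theta) <= conjugate Psi eps)%E.

(* Whenever some mini-batch violates max_criterion at theta_k, so does the
   sampled one. This includes the runs whose bs k attains the maximum, and all
   runs if m = n. *)
Definition samples_violations (alpha : R) (theta0 eps : V)
    (bs : nat -> {set 'I_n}) : Prop :=
  forall k, ~ max_criterion eps (iterate alpha theta0 bs k) ->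
    (conjugate Psi eps
     < conjugate Psi (dGavg (bs k) (iterate alpha theta0 bs k)))%E.

End SGD.

(* k iterations are within a (real) budget b, rounded up to an integer. *)
Definition affordable (R : realType) (k : nat) (b : R) : Prop :=
  (k%:Z <= Num.ceil b)%R.

(* Main.v *)
(* One step from theta along the batch B decreases Gavg B by at least
   Psi^*(grad), by smoothness and the Fenchel equality at the gradient of Psi^*;
   the complementary samples contribute at most M. Hence n Gs drops by at least
   m Psi^*(grad) - (n - m) M per step, and as Gs is bounded below, Psi^*(grad)
   cannot stay above Psi^*(eps) for long: this is (1). For (2), convexity bounds
   Gavg B - Gstar B by psi^*(grad), and Psi^*, psi^* order vectors in the same
   way when they are radial for one norm; averaging over B turns the sum of the
   Gstar B into the capacity risk. For (3), the two estimates combine into a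
   contraction of the expected gap, by the factor 1 - m t / n, towards a fixed
   floor. *)

Require Import Defs.
From HB Require Import structures.
From mathcomp Require Import all_boot all_order all_algebra.
From mathcomp Require Import all_classical all_reals all_analysis.
From mathcomp Require Import ring lra.

Import Order.TTheory GRing.Theory Num.Theory.
Import numFieldNormedType.Exports.

Local Open Scope classical_set_scope.
Local Open Scope ring_scope.

(** * The coordinate dot product: bilinearity, bounds, continuity *)

Section Dot.
Context {R : realType} {d : nat}.
Implicit Types u v w : 'rV[R]_d.

Lemma dotDl u v w : dot (u + v) w = dot u w + dot v w.
Proof.
by rewrite -big_split; apply: eq_bigr => i _; rewrite !mxE mulrDl.
Qed.

Lemma dotZl a u v : dot (a *: u) v = a * dot u v.
Proof. by rewrite mulr_sumr; apply: eq_bigr => i _; rewrite !mxE mulrA. Qed.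

Lemma dotC u v : dot u v = dot v u.
Proof. by apply: eq_bigr => i _; rewrite mulrC. Qed.

Lemma dotDr u v w : dot w (u + v) = dot w u + dot w v.
Proof. by rewrite dotC dotDl !(dotC w). Qed.

Lemma dotZr a u v : dot u (a *: v) = a * dot u v.
Proof. by rewrite dotC dotZl dotC. Qed.

Lemma dotNl u v : dot (- u) v = - dot u v.
Proof. by rewrite -scaleN1r dotZl mulN1r. Qed.

Lemma dotNr u v : dot u (- v) = - dot u v.
Proof. by rewrite dotC dotNl dotC. Qed.

Lemma dotBl u v w : dot (u - v) w = dot u w - dot v w.
Proof. by rewrite dotDl dotNl. Qed.

Lemma dotBr u v w : dot w (u - v) = dot w u - dot w v.
Proof. by rewrite dotDr dotNr. Qed.

Lemma dot0l u : dot 0 u = 0.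
Proof. by rewrite -(scale0r (0 : 'rV_d)) dotZl mul0r. Qed.

Lemma dot0r u : dot u 0 = 0.
Proof. by rewrite dotC dot0l. Qed.

Lemma dot_sumr u (I : finType) (P : pred I) (F : I -> 'rV[R]_d) :
  dot u (\sum_(i | P i) F i) = \sum_(i | P i) dot u (F i).
Proof.
by apply: (big_morph (dot u)) => [v w|]; rewrite ?dot0r ?dotDr.
Qed.

Lemma dot_delta u i : dot u 'e_i = u 0 i.
Proof.
rewrite /dot (bigD1 i)//= !mxE !eqxx mulr1 big1 ?addr0// => j ji.
by rewrite !mxE eqxx (negbTE ji) mulr0.
Qed.

Lemma norm_coord_le u i : `|u 0 i| <= `|u|.
Proof.
rewrite [leRHS]/Num.norm /= mx_normrE.
by apply/bigmax_geP; right => /=; exists (0, i).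
Qed.

Lemma norm_coord u : u != 0 -> exists i, `|u| = `|u 0 i|.
Proof.
rewrite -normr_eq0 => /mx_norm_neq0[[j i] /= ui].
by exists i; rewrite -(ord1 j).
Qed.

Lemma norm_delta i : `|'e_i : 'rV[R]_d| <= 1.
Proof.
have [->|e0] := eqVneq ('e_i : 'rV[R]_d) 0; first by rewrite normr0.
have [j ->] := norm_coord _ e0; rewrite !mxE.
by case: (_ && _); rewrite ?normr1 ?normr0.
Qed.

(** The norm on row vectors is the largest absolute coordinate, hence one product of norms for each
    of the [d] terms. *)
Lemma dot_le_norm u v : `|dot u v| <= d%:R * `|u| * `|v|.
Proof.
rewrite -mulrA mulr_natl -[X in _ *+ X]card_ord -sumr_const.
apply: le_trans (ler_norm_sum _ _ _) _; apply: ler_sum => i _.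
by rewrite normrM ler_pM ?normr_ge0 ?norm_coord_le.
Qed.

(** Feeds the linear structure declared next, through which [dot mu] can be proposed as a
    differential. *)
Lemma dot_is_linear u : linear (dot u : 'rV[R]_d -> R^o).
Proof. by move=> a v w; rewrite dotDr dotZr. Qed.

HB.instance Definition _ u :=
  GRing.isLinear.Build R 'rV[R]_d R^o _ (dot u) (dot_is_linear u).

Lemma dot_continuous u : continuous (dot u).
Proof.
apply/linear_bounded_continuous/linear_boundedP; near=> r => v.
by apply: le_trans (dot_le_norm u v) _; apply: ler_wpM2r.
Unshelve. all: by end_near. Qed.

End Dot.

(** * Conjugates of energy functions: existence and uniqueness of maximizers *)

Section Fenchel.
Context {R : realType} {d : nat}.
Local Notation V := 'rV[R]_d.
Implicit Types (Psi : V -> R) (mu nu : V).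

Lemma conjugate_ge Psi mu nu :
  ((dot mu nu - Psi mu)%:E <= conjugate Psi nu)%E.
Proof. by apply: ereal_sup_ubound; exists mu. Qed.

Lemma conjugate_le Psi nu (c : \bar R) :
  (forall mu, (dot mu nu - Psi mu)%:E <= c)%E -> (conjugate Psi nu <= c)%E.
Proof. by move=> le_c; apply: ge_ereal_sup => _ [mu _ <-]. Qed.

Lemma conjugate_ltNy Psi nu : (-oo < conjugate Psi nu)%E.
Proof. exact: lt_le_trans (ltNyr _) (conjugate_ge Psi 0 nu). Qed.

Lemma conjugate_max Psi mu nu :
  (forall mu', dot mu' nu - Psi mu' <= dot mu nu - Psi mu) ->
  conjugate Psi nu = (dot mu nu - Psi mu)%:E.
Proof.
move=> mu_max; apply/eqP; rewrite eq_le conjugate_ge andbT.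
by apply: conjugate_le => mu'; rewrite lee_fin.
Qed.

Definition convex_fun (F : V -> R) := forall (x y : V) (t : R), 0 <= t <= 1 ->
  F (t *: x + (1 - t) *: y) <= t * F x + (1 - t) * F y.

Section Energy.
Variable Psi : V -> R.
Hypothesis ePsi : energy Psi.

Lemma energy_convex : convex_fun Psi.
Proof.
case: ePsi => -[_ _ cPsi _ _] _ _ x y t t01.
by have := cPsi x y t t01; rewrite -!EFinM -EFinD lee_fin.
Qed.

(** A real-valued function has the whole space as effective domain, so essential smoothness covers
    every point. *)
Lemma energy_differentiable x : differentiable Psi x.
Proof.
case: ePsi => -[_ _ _ [_ dPsi _] _] _ _.
suff int : (edom (fun x => (Psi x)%:E))° x by have [_] := dPsi x int.
by apply: filterS (@filterT _ _ _) => y _; rewrite /edom/= ltry.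
Qed.

Lemma energy_continuous : continuous Psi.
Proof.
by move=> x; apply: differentiable_continuous; exact: energy_differentiable.
Qed.

Lemma energy_even x : Psi (- x) = Psi x.
Proof.
case: ePsi => _ _ [N [[_ _ NZ _] [Psi0 PsiE]]].
by rewrite !PsiE -scaleN1r NZ normrN1 mul1r.
Qed.

Lemma energy_min x : Psi 0 <= Psi x.
Proof.
case: ePsi => _ Pmin _; have [->//|x0] := eqVneq x 0.
exact/ltW/Pmin.
Qed.

Lemma conjugate0 : conjugate Psi 0 = (- Psi 0)%:E.
Proof.
rewrite (conjugate_max Psi 0) ?dot0r ?sub0r// => mu.
by rewrite !dot0r !sub0r lerN2 energy_min.
Qed.

(* The maximizers form a convex set of points where nu is a subgradient, so
   essential strict convexity applies on it. *)
Lemma energy_argmax_unique nu mu1 mu2 :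
  (forall mu, dot mu nu - Psi mu <= dot mu1 nu - Psi mu1) ->
  (forall mu, dot mu nu - Psi mu <= dot mu2 nu - Psi mu2) -> mu1 = mu2.
Proof.
move=> max1 max2; apply/eqP/negP => /negP mu12.
case: ePsi => -[_ _ _ _ sPsi] _ _.
pose C : set V :=
  [set mu | forall mu', dot mu' nu - Psi mu' <= dot mu nu - Psi mu].
have C_convex : convex_set (C : set (convex_lmodType V)).
  move=> x y k; rewrite !inE => Cx Cy mu'.
  have k01 : 0 <= k%:num <= 1 by rewrite ge0 le1.
  have cv := energy_convex x y _ k01.
  rewrite /conv/=; set z : V := _ + _ in cv *.
  have -> : dot z nu = k%:num * dot x nu + (1 - k%:num) * dot y nu.
    by rewrite dotDl !dotZl.
  have := Cx mu'; have := Cy mu'; nra.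
have C_sub : C `<=` dom_subdifferential (fun x => (Psi x)%:E).
  move=> x Cx; exists nu => y; rewrite -EFinD lee_fin dotBr.
  by have := Cx y; rewrite ![dot _ nu]dotC; lra.
have half01 : 0 < (2^-1 : R) < 1 by lra.
have := sPsi C C_convex C_sub mu1 mu2 2^-1 max1 max2 mu12 half01.
rewrite -!EFinM -EFinD lte_fin.
have := max1 (2^-1 *: mu1 + (1 - 2^-1) *: mu2); rewrite dotDl !dotZl.
have := max1 mu2; have := max2 mu1; lra.
Qed.

(** Finiteness of the conjugate on a ball around [nu] makes the objective decay linearly in the norm
    of [mu], which reduces the search to a compact ball. *)
Lemma energy_argmax nu : (edom (conjugate Psi))° nu ->
  exists mu, forall mu', dot mu' nu - Psi mu' <= dot mu nu - Psi mu.
Proof.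
rewrite /interior => /nbhs_ballP[r0 /= r0_gt0 ball_dom].
pose r := r0 / 2; have r_gt0 : 0 < r by rewrite divr_gt0.
have fin (e : V) : `|e| <= r -> conjugate Psi (nu + e) \is a fin_num.
  move=> er; rewrite fin_numElt conjugate_ltNy /=; apply: ball_dom.
  rewrite -ball_normE /= opprD addrA subrr sub0r normrN.
  by apply: le_lt_trans er _; rewrite /r; lra.
pose K (e : V) := `|fine (conjugate Psi (nu + e))|.
have ge_K (e mu : V) : `|e| <= r ->
    dot mu nu + dot mu e - Psi mu <= K e.
  move=> er; rewrite -dotDr; apply: le_trans (ler_norm _).
  by rewrite -lee_fin fineK ?fin// conjugate_ge.
(* Testing [mu] against the signed direction of its largest coordinate gives the slope [r]; [k]
   bounds all the conjugate values that can occur, and [K 0] serves the case [mu = 0]. *)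
pose k := K 0 + \sum_i (K (r *: 'e_i) + K (- (r *: 'e_i))).
have coercive mu : dot mu nu - Psi mu <= k - r * `|mu|.
  have sum_ge0 i : 0 <= K (r *: 'e_i) + K (- (r *: 'e_i)).
    by rewrite addr_ge0 ?normr_ge0.
  have [->|/(norm_coord _)[i mu_i]] := eqVneq mu 0.
    rewrite normr0 mulr0 subr0.
    have := ge_K 0 0; rewrite normr0 !dot0r addr0 => /(_ (ltW r_gt0)).
    by move=> /le_trans; apply; rewrite lerDl sumr_ge0.
  have ei : `|r *: 'e_i : V| <= r.
    rewrite normrZ gtr0_norm// -[leRHS]mulr1 ler_pM2l//.
    exact: norm_delta.
  have k_ge : K (r *: 'e_i) + K (- (r *: 'e_i)) <= k.
    by rewrite /k (bigD1 i)//= addrCA lerDl addr_ge0 ?normr_ge0 ?sumr_ge0.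
  have := ge_K _ mu ei; have := ge_K (- (r *: 'e_i)) mu.
  rewrite normrN => /(_ ei); rewrite dotNr dotZr dot_delta mu_i.
  have := normr_ge0 (fine (conjugate Psi (nu + r *: 'e_i))).
  have := normr_ge0 (fine (conjugate Psi (nu - r *: 'e_i))).
  rewrite -/(K _) -/(K _).
  by have [?|?] := ger0P (mu 0 i); nra.
(* Beyond this radius the objective is below [- Psi 0], its value at the origin. *)
pose r1 := (k + Psi 0) / r.
pose A : set V := [set mu | `|mu| <= r1].
have A0 : A 0.
  rewrite /A/= normr0 divr_ge0 ?(ltW r_gt0)//.
  by have := coercive 0; rewrite dot0l normr0; lra.
have cA : compact A.
  apply: bounded_closed_compact.
    exists r1; split=> [|x r1x mu /= Amu]; first exact: num_real.
    by rewrite (le_trans Amu) ?ltW.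
  have -> : A = (fun mu => `|mu|) @^-1` [set x | x <= r1] by [].
  apply: preimage_closed => [x _|]; last exact: closed_le.
  exact: norm_continuous.
have [||mu Amu mu_max] :=
    compact_EVT_max (f := fun mu => dot nu mu - Psi mu) _ cA.
- by exists 0.
- apply: continuous_subspaceT => mu.
  exact: (continuousB (dot_continuous nu mu) (energy_continuous mu)).
exists mu => mu'; rewrite !(dotC _ nu).
have [Amu'|] := leP `|mu'| r1; first by apply: mu_max; rewrite inE.
move=> r1mu'; have := mu_max 0; rewrite inE => /(_ A0); apply: le_trans.
have := coercive mu'; rewrite dotC dot0r.
have : k + Psi 0 < r * `|mu'| by rewrite mulrC -ltr_pdivrMr.
lra.
Qed.

End Energy.
End Fenchel.

(** * Differentiability of the conjugate at points with a strict maximizer *)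

Section ConjugateGradient.
Context {R : realType} {d : nat}.
Local Notation V := 'rV[R]_d.

(** Compactness of the sphere turns pointwise strictness into a uniform margin. *)
Lemma strict_min_sphere (F : V -> R) (a : V) (e : R) :
  continuous F -> (forall x, x != a -> F a < F x) -> 0 < e ->
  exists2 delta, 0 < delta & forall x, `|x - a| = e -> F a + delta <= F x.
Proof.
move=> cF Fmin e_gt0; pose S : set V := [set x | `|x - a| = e].
have neqa x : S x -> x != a.
  apply: contraPneq => ->; rewrite /S/= subrr normr0 => /esym/eqP.
  by rewrite gt_eqF.
(* In dimension 0 the sphere is empty and any margin works. *)
have [S0|S0] := pselect (S !=set0); last first.
  by exists 1 => // x Sx; case: S0; exists x.
have cS : compact S.
  apply: bounded_closed_compact.
    exists (`|a| + e); split=> [|r ltr x /= Sx]; first exact: num_real.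
    by rewrite -(subrK a x) (le_trans (ler_normD _ _))// Sx addrC ltW.
  have -> : S = (fun x => `|x - a|) @^-1` [set r | r = e] by [].
  apply: preimage_closed => [x _|]; last exact: closed_eq.
  apply: (@continuous_comp _ _ _ (fun x : V => x - a) Num.norm).
    exact: (continuousB (@cvg_id _ (nbhs x)) (@cst_continuous _ _ a x)).
  exact: norm_continuous.
have [b /[!inE] Sb Fb] := compact_EVT_min S0 cS (continuous_subspaceT cF).
exists (F b - F a); first by rewrite subr_gt0 Fmin ?neqa.
by move=> x Sx; rewrite addrC subrK Fb// inE.
Qed.

(** The segment from [a] to [x] meets the sphere at parameter [t = e / |x - a|]; convexity along it
    carries the margin outwards, in proportion to the distance. *)
Lemma convex_growth (F : V -> R) (a : V) (e delta : R) :
  convex_fun F -> 0 < e ->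
  (forall x, `|x - a| = e -> F a + delta <= F x) ->
  forall x, e <= `|x - a| -> F a + delta / e * `|x - a| <= F x.
Proof.
move=> cF e_gt0 sphere x ex; pose t := e / `|x - a|.
have xa_gt0 : 0 < `|x - a| by exact: lt_le_trans ex.
have t_gt0 : 0 < t by rewrite divr_gt0.
have t01 : 0 <= t <= 1 by rewrite ltW//= ler_pdivrMr// mul1r.
have := sphere (t *: x + (1 - t) *: a).
have -> : t *: x + (1 - t) *: a - a = t *: (x - a).
  by rewrite scalerBl scale1r addrCA addrAC subrr add0r scalerBr.
rewrite normrZ gtr0_norm// divfK ?gt_eqF// => /(_ erefl).
move=> /le_trans/(_ (cF _ _ _ t01)) le_t.
have -> : delta / e * `|x - a| = delta / t.
  by rewrite /t; field; rewrite !gt_eqF.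
rewrite -lerBrDl ler_pdivrMr//; lra.
Qed.

(** Moving [nu] by [h] adds [dot x h] to the objective at [x]. Close to [mu] this differs from
    [dot mu h] by at most [eps * |h|]; far from [mu] the linear growth of [F] outweighs the
    difference. The remainder is therefore little-o of [h]. *)
Lemma convex_conjugate_grad (Psi : V -> R) (nu mu : V) :
  convex_fun Psi -> continuous Psi ->
  (forall mu', mu' != mu -> dot mu' nu - Psi mu' < dot mu nu - Psi mu) ->
  egrad (conjugate Psi) nu = mu.
Proof.
move=> cvPsi ctPsi mu_max.
pose F x := Psi x - dot nu x.
have cvF : convex_fun F.
  move=> x y t t01; rewrite /F dotDr !dotZr.
  by have := cvPsi x y t t01; lra.
have ctF : continuous F.
  by move=> x; exact: (continuousB (ctPsi x) (dot_continuous nu x)).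
have Fmin x : x != mu -> F mu < F x.
  by move=> /mu_max; rewrite /F !(dotC _ nu); lra.
pose f := conjugate Psi.
have f_nu : f nu = (dot mu nu - Psi mu)%:E.
  apply: conjugate_max => mu'; have [->//|/mu_max/ltW//] := eqVneq mu' mu.
have near_nu (eps : R) : 0 < eps -> \forall h \near (0 : V),
    f (h + nu) \is a fin_num /\
    0 <= fine (f (h + nu)) - fine (f nu) - dot mu h <= eps * `|h|.
  (* Using [d.+1] in place of [d] keeps the divisor positive in dimension 0. *)
  move=> eps_gt0; pose e := eps / d.+1%:R.
  have d_gt0 : 0 < d.+1%:R :> R by rewrite ltr0n.
  have e_gt0 : 0 < e by rewrite divr_gt0.
  have [delta delta_gt0 sphere] := strict_min_sphere F mu e ctF Fmin e_gt0.
  have growth := convex_growth _ _ _ _ cvF e_gt0 sphere.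
  (* For [|h| < r], the term [dot (x - mu) h] grows no faster than [delta / e * |x - mu|], the
     growth of [F] away from [mu]. *)
  pose r := delta / e / d.+1%:R.
  have r_gt0 : 0 < r by rewrite !divr_gt0.
  apply/nbhs_ballP; exists r => //= h.
  rewrite -ball_normE /= sub0r normrN => h_lt.
  have dotle u : dot u h <= d.+1%:R * `|u| * `|h|.
    apply: le_trans (ler_norm _) (le_trans (dot_le_norm _ _) _).
    by rewrite -!mulrA ler_wpM2r ?mulr_ge0// ler_nat.
  have upper :
      (f (h + nu)%R <= (dot mu nu - Psi mu + dot mu h + eps * `|h|)%:E)%E.
    apply: conjugate_le => x; rewrite lee_fin dotDr.
    have split_dot : dot x h = dot mu h + dot (x - mu) h by rewrite dotBl; ring.
    have dot_xh := dotle (x - mu).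
    have eps_h : 0 <= eps * `|h| by rewrite mulr_ge0// ltW.
    have [xe|/ltW xe] := leP e `|x - mu|.
      have := growth x xe; rewrite /F !(dotC nu).
      have : d.+1%:R * `|x - mu| * `|h| <= delta / e * `|x - mu|.
        rewrite mulrAC ler_wpM2r// mulrC -ler_pdivlMr//.
        exact: ltW.
      lra.
    have : dot x nu - Psi x <= dot mu nu - Psi mu.
      by have := conjugate_ge Psi x nu; rewrite -/f f_nu lee_fin.
    have : d.+1%:R * `|x - mu| * `|h| <= eps * `|h|.
      by rewrite ler_wpM2r// mulrC -ler_pdivlMr.
    lra.
  have lower := conjugate_ge Psi mu (h + nu).
  have fin : f (h + nu) \is a fin_num.
    by rewrite fin_numElt conjugate_ltNy (le_lt_trans upper) ?ltry.
  split=> //; move: upper lower; rewrite -/f -(fineK fin) !lee_fin f_nu dotDr/=.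
  lra.
pose g : V -> R^o := fine \o f.
pose L : {linear V -> R^o} := dot mu.
have f_diff : g \o shift nu = cst (g nu) + L +o_ (0 : V) id.
  apply: (iffRL (@eqaddoP R V R^o V _ _ _ _)) => eps /near_nu.
  apply: filterS => h [_ /andP[ge0 le_eps]].
  rewrite [X in `|X|](_ : _ = fine (f (h + nu)) - fine (f nu) - dot mu h).
    by rewrite ger0_norm.
  by rewrite !fctE /= opprD addrA.
have df := @diff_unique R V R^o g L nu (dot_continuous mu) f_diff.
have dif : differentiable g nu.
  apply/diff_locallyP; split; first by rewrite df; exact: dot_continuous.
  by rewrite df.
have edif : edifferentiable f nu.
  split=> //; rewrite (near_shift 0).
  by apply: filterS (near_nu 1 ltr01) => h [+ _]; rewrite /= subr0.
rewrite /egrad asboolT// /grad asboolT//; apply/rowP => i.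
by rewrite mxE deriveE// df; exact: dot_delta.
Qed.
End ConjugateGradient.

(** * Fenchel equality, and comparison of conjugates that are radial for one norm *)

Section Radial.
Context {R : realType} {d : nat}.
Local Notation V := 'rV[R]_d.
Implicit Types Psi psi : V -> R.

Lemma conjugate_egrad Psi nu : energy Psi -> (edom (conjugate Psi))° nu ->
  conjugate Psi nu =
    (dot (egrad (conjugate Psi) nu) nu - Psi (egrad (conjugate Psi) nu))%:E.
Proof.
move=> ePsi /(energy_argmax _ ePsi)[mu mu_max].
rewrite (convex_conjugate_grad Psi nu mu).
- exact: conjugate_max.
- exact: energy_convex.
- exact: energy_continuous.
(* The maximum is strict: a point doing as well as [mu] is itself a maximizer, and maximizers are
   unique. *)
move=> mu'; apply: contraNlt => le_mu'; apply/eqP.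
apply: (energy_argmax_unique _ ePsi nu) => // x.
exact: le_trans (mu_max x) le_mu'.
Qed.

(** Since [Psi] is even, its difference quotients at [h] and [- h] are opposite. Near 0 both lie
    within [a] of one derivative, so they cannot have absolute value [a] or more. *)
Lemma energy_no_linear_growth Psi (mu : V) (a : R) : energy Psi ->
  (forall h, h * a <= Psi (h *: mu) - Psi 0) -> a <= 0.
Proof.
move=> ePsi growth; rewrite leNgt; apply/negP => a_gt0.
have : derivable (Psi : V -> R^o) 0 mu.
  by apply: diff_derivable; exact: energy_differentiable.
move=> /cvg_ex[D /cvgrPdist_lt/(_ _ a_gt0)].
move=> /nbhs_ballP[e /= e_gt0 near_D].
have quot h : 0 < `|h| < e -> `|D - h^-1 * (Psi (h *: mu) - Psi 0)| < a.
  move=> /andP[h_neq0 h_lt].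
  have := near_D h; rewrite -ball_normE /= sub0r normrN addr0.
  by apply => //; rewrite -normr_gt0.
pose h := e / 2; have h_gt0 : 0 < h by rewrite divr_gt0.
have h_lt : 0 < `|h| < e by rewrite gtr0_norm// h_gt0/= /h; lra.
have := quot h h_lt; have := quot (- h); rewrite normrN => /(_ h_lt).
rewrite scaleNr energy_even// invrN mulNr opprK.
have : a <= h^-1 * (Psi (h *: mu) - Psi 0) by rewrite mulrC ler_pdivlMr// mulrC.
rewrite !ltr_norml; lra.
Qed.

(* If mu witnesses psi^*(eps) < psi^*(nu), then rescaling mu to any radius
   gives Psi^*(nu) an advantage over Psi^*(eps) that is proportional to the
   radius, so near maximizers for eps would accumulate at the origin, where
   Psi has zero slope. *)
Lemma conjugate_radial_mono N Psi psi (nu eps : V) :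
  energy Psi -> radial N Psi -> radial N psi ->
  conjugate Psi eps \is a fin_num ->
  (conjugate Psi nu <= conjugate Psi eps)%E ->
  (conjugate psi nu <= conjugate psi eps)%E.
Proof.
move=> ePsi [[N_ge0 N_eq0 NZ _] [Psi0 PsiE]] [_ [psi0 psiE]] fin le_Psi.
apply: conjugate_le => mu; rewrite leNgt; apply/negP => gap.
have fin_eps : conjugate psi eps \is a fin_num.
  by rewrite fin_numElt conjugate_ltNy (lt_trans gap) ?ltry.
pose delta := dot mu nu - psi mu - fine (conjugate psi eps).
have delta_gt0 : 0 < delta by rewrite subr_gt0 -lte_fin fineK.
pose a := dot mu nu; pose r := N mu.
(* [psi] is constant on the sphere of radius [r], so the gap between conjugates becomes a gap
   between dot products. *)
have beat mu' : N mu' = r -> dot mu' eps + delta <= a.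
  move=> Nmu'; have := conjugate_ge psi mu' eps.
  rewrite -(fineK fin_eps) lee_fin !psiE Nmu' /delta psiE -/r; rewrite /a; lra.
have NN x : N (- x) = N x by rewrite -scaleN1r NZ normrN1 mul1r.
have a_gt0 : 0 < a.
  have := beat mu erefl; have := beat (- mu).
  by rewrite NN dotNl => /(_ erefl); lra.
have r_gt0 : 0 < r.
  rewrite lt_neqAle N_ge0 andbT; apply/eqP => /esym/N_eq0 mu0.
  by move: a_gt0; rewrite /a mu0 dot0l ltxx.
have beat_scaled x : dot x eps + delta * (N x / r) <= N x / r * a.
  have [/N_eq0->|/eqP Nx0] := pselect (N x = 0).
    by rewrite -(scale0r (0 : V)) NZ normr0 dotZl !mul0r mulr0 addr0.
  have Nx_gt0 : 0 < N x by rewrite lt_neqAle N_ge0 eq_sym Nx0.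
  have := beat ((r / N x) *: x).
  rewrite NZ gtr0_norm ?divr_gt0// divfK// => /(_ erefl); rewrite dotZl.
  rewrite -(ler_pM2l (divr_gt0 Nx_gt0 r_gt0)); congr (_ <= _).
  by field; rewrite Nx0 gt_eqF.
pose S := fine (conjugate Psi eps).
have nu_le x : dot x nu - Psi x <= S.
  by rewrite -lee_fin fineK//; exact: le_trans (conjugate_ge _ _ _) le_Psi.
(* The multiple of [mu] with the same [N]-radius as [x] has the same value of [Psi] and competes in
   the conjugate at [nu]. *)
have advantage x : dot x eps - Psi x + delta * (N x / r) <= S.
  have := nu_le ((N x / r) *: mu); rewrite dotZl -/a.
  have -> : Psi ((N x / r) *: mu) = Psi x.
    by rewrite !PsiE NZ ger0_norm ?divr_ge0 ?(ltW r_gt0)// divfK// gt_eqF.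
  by have := beat_scaled x; lra.
(* Adding [k] times [advantage] to [beat_scaled] with [Psi 0 <= Psi x] cancels the terms in
   [N x / r * a]; this dictates [k = a / delta]. *)
have S_le : S <= - Psi 0.
  pose k := a / delta; have k_ge0 : 0 <= k by rewrite divr_ge0// ltW.
  have k1_gt0 : 0 < 1 + k by lra.
  suff : S <= (S * k - Psi 0) / (1 + k) by rewrite ler_pdivlMr//; lra.
  rewrite -lee_fin fineK//; apply: conjugate_le => x.
  rewrite lee_fin ler_pdivlMr//.
  have : k * (delta * (N x / r)) <= k * (S - (dot x eps - Psi x)).
    by rewrite ler_wpM2l//; have := advantage x; lra.
  have -> : k * (delta * (N x / r)) = N x / r * a.
    by rewrite /k; field; rewrite !gt_eqF.
  have := beat_scaled x; have := energy_min _ ePsi x.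
  have : 0 <= delta * (N x / r).
    by rewrite mulr_ge0 ?divr_ge0 ?(ltW delta_gt0) ?(ltW r_gt0).
  lra.
(* Along the line spanned by [mu], [nu_le] and [S_le] now make [Psi] grow with slope [a] from its
   minimum. *)
suff : a <= 0 by lra.
apply: (energy_no_linear_growth Psi mu) => // h.
by have := nu_le (h *: mu); rewrite dotZl -/a; lra.
Qed.
End Radial.

(** * Descent and suboptimality bounds from Bregman inequalities *)

Section Bregman.
Context {R : realType} {d : nat}.
Local Notation V := 'rV[R]_d.
Implicit Types (Psi psi h : V -> R) (dh : V -> V).

(** Smoothness at displacement [- mu], with [mu] the gradient of the conjugate, changes [h] by at
    most [Psi mu - dot mu (dh theta)]; Fenchel equality identifies this with minus the conjugate. *)
Lemma generalized_descent Psi h dh (theta : V) : energy Psi ->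
  (forall mu nu, bregman h dh mu nu <= Psi (mu - nu)) ->
  (edom (conjugate Psi))° (dh theta) ->
  conjugate Psi (dh theta) \is a fin_num /\
  h (theta - 1 *: egrad (conjugate Psi) (dh theta)) <=
    h theta - fine (conjugate Psi (dh theta)).
Proof.
move=> ePsi smooth dom; rewrite (conjugate_egrad _ _ ePsi dom).
set mu := egrad _ _; split=> //=; rewrite scale1r.
have := smooth (theta - mu) theta; rewrite /bregman.
have -> : theta - mu - theta = - mu by rewrite addrAC subrr add0r.
by rewrite dotNr energy_even// (dotC mu); lra.
Qed.

(** Convexity bounds [h mu] below by its linearization plus [psi (mu - theta)]; evenness of [psi]
    makes [theta - mu] a competitor in the conjugate, uniformly in [mu]. *)
Lemma suboptimality_le_conjugate psi h dh (theta : V) : energy psi ->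
  (forall mu nu, psi (mu - nu) <= bregman h dh mu nu) ->
  ((h theta - inf (range h))%:E <= conjugate psi (dh theta))%E.
Proof.
move=> epsi cvx; have := conjugate_ltNy psi (dh theta).
have := conjugate_ge psi _ (dh theta).
case: conjugate => [c| |]// le_c _; last exact: leey.
rewrite lee_fin lerBlDr -lerBlDl.
apply: lb_le_inf; first by exists (h theta), theta.
move=> _ [mu _ <-]; have := le_c (- (mu - theta)).
rewrite lee_fin energy_even// dotNl.
by have := cvx mu theta; rewrite /bregman (dotC (dh theta)); lra.
Qed.
End Bregman.

(** * Averages over batches and uniform sampling of batches *)

Section Batches.
Context {R : realType} {d n : nat} {Z : Type}.
Local Notation V := 'rV[R]_d.
Variables (G : Z -> V -> R) (s : 'I_n -> Z).
Implicit Types (B : {set 'I_n}) (theta : V).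

(** The Bregman expression is linear in the pair [(h, dh)]; this transfers smoothness and convexity
    from samples to batches. *)
Lemma bregman_Gavg B (mu nu : V) :
  bregman (Gavg G s B) (dGavg G s B) mu nu =
  #|B|%:R^-1 * \sum_(i in B) bregman (G (s i)) (grad (G (s i))) mu nu.
Proof.
rewrite /bregman /Gavg /dGavg dotZl (dotC (\sum_(i in B) _)) dot_sumr.
rewrite !sumrB !mulrBr; congr (_ - _ * _).
by apply: eq_bigr => i _; rewrite dotC.
Qed.

Lemma mulr_avg B (x : R) : (0 < #|B|)%N ->
  x = #|B|%:R^-1 * \sum_(i in B) x.
Proof.
by move=> B0; rewrite sumr_const -[x *+ _]mulr_natl mulKf// pnatr_eq0 -lt0n.
Qed.

Lemma Gavg_smooth Psi B : (forall z, H_smooth Psi (G z) (grad (G z))) ->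
  (0 < #|B|)%N -> forall mu nu : V,
  bregman (Gavg G s B) (dGavg G s B) mu nu <= Psi (mu - nu).
Proof.
move=> smooth B0 mu nu; rewrite bregman_Gavg (mulr_avg B (Psi _))//.
rewrite ler_wpM2l ?invr_ge0//; apply: ler_sum => i _.
by case: (smooth (s i)).
Qed.

Lemma Gavg_convex psi B : (forall z, H_convex psi (G z) (grad (G z))) ->
  (0 < #|B|)%N -> forall mu nu : V,
  psi (mu - nu) <= bregman (Gavg G s B) (dGavg G s B) mu nu.
Proof.
move=> cvx B0 mu nu; rewrite bregman_Gavg (mulr_avg B (psi _))//.
rewrite ler_wpM2l ?invr_ge0//; apply: ler_sum => i _.
by case: (cvx (s i)).
Qed.

(** For empty [B] both sides are 0, a case that arises as the complement of a full batch. *)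
Lemma mulr_Gavg B theta :
  #|B|%:R * Gavg G s B theta = \sum_(i in B) G (s i) theta.
Proof.
have [B0|B0] := eqVneq #|B| 0%N; last by rewrite mulVKf// pnatr_eq0.
by rewrite B0 mul0r (cards0_eq B0) big_set0.
Qed.

Lemma Gavg_split B theta : n%:R * Gavg G s [set: 'I_n]%SET theta =
  #|B|%:R * Gavg G s B theta + (n%:R - #|B|%:R) * Gavg G s (~: B) theta.
Proof.
have cardn : #|[set: 'I_n]%SET| = n by rewrite cardsT card_ord.
have cardC : n%:R - #|B|%:R = #|~: B|%:R :> R.
  by rewrite -[in n%:R](card_ord n) -(cardsC B) natrD addrAC subrr add0r.
rewrite cardC -[in n%:R]cardn !mulr_Gavg (bigID (mem B)) /=.
by congr (_ + _); apply: eq_bigl => i; rewrite !inE.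
Qed.

Variable m : nat.
Hypothesis m_n : (0 < m <= n)%N.

Lemma Ebatch_le (F F' : {set 'I_n} -> R) :
  (forall B, #|B| = m -> F B <= F' B) -> Ebatch m F <= Ebatch m F'.
Proof.
move=> leF; rewrite /Ebatch ler_wpM2l ?invr_ge0//.
by apply: ler_sum => B /eqP; exact: leF.
Qed.

Lemma bin_neq0 : 'C(n, m)%:R != 0 :> R.
Proof. by rewrite pnatr_eq0 -lt0n bin_gt0; case/andP: m_n. Qed.

Lemma Ebatch_linear (F F' : {set 'I_n} -> R) (a : R) :
  Ebatch m (fun B => a * F B + F' B) = a * Ebatch m F + Ebatch m F'.
Proof. by rewrite /Ebatch big_split/= mulrDr -mulr_sumr mulrCA. Qed.

Lemma Ebatch_cst (c : R) : Ebatch m (fun _ : {set 'I_n} => c) = c.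
Proof.
rewrite /Ebatch sumr_const -[c *+ _]mulr_natl.
have -> : #|[pred B : {set 'I_n} | #|B| == m]| = 'C(n, m).
  by rewrite -[in RHS](card_ord n) -card_draws cardsE.
by rewrite mulKf// bin_neq0.
Qed.

(** The batches avoiding [i] are the [m]-subsets of the other [n.-1] indices; Pascal's rule leaves
    the count of those containing [i]. *)
Lemma card_draws_mem (i : 'I_n) :
  #|[set B : {set 'I_n} | (#|B| == m) && (i \in B)]%SET| = 'C(n.-1, m.-1).
Proof.
have : #|[set B : {set 'I_n} | #|B| == m]%SET| = 'C(n, m).
  by rewrite card_draws card_ord.
rewrite -(cardsID [set B : {set 'I_n} | i \in B]%SET).
have -> : ([set B : {set 'I_n} | #|B| == m] :&: [set B : {set 'I_n} | i \in B]
        = [set B : {set 'I_n} | (#|B| == m) && (i \in B)])%SET.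
  by apply/setP => B; rewrite !inE.
have -> : #|([set B : {set 'I_n} | #|B| == m]
              :\: [set B : {set 'I_n} | i \in B])%SET|
        = 'C(n.-1, m).
  rewrite -[n in RHS](card_ord n) -(cardsC1 i) -cards_draws.
  by apply: eq_card => B; rewrite !inE finset.subsetC finset.sub1set inE.
have -> : 'C(n, m) = ('C(n.-1, m.-1) + 'C(n.-1, m))%N.
  by case: (n) (m) m_n => [|n'] [|m']//= _; rewrite binS addnC.
exact: addIn.
Qed.

(** Double counting: every sample lies in the same number of batches, and
    [n * 'C(n.-1, m.-1) = m * 'C(n, m)]. *)
Lemma Ebatch_Gavg theta :
  Ebatch m (fun B => Gavg G s B theta) = Gavg G s [set: 'I_n]%SET theta.
Proof.
case/andP: (m_n) => m_gt0 mn; have n_gt0 := leq_trans m_gt0 mn.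
have m_neq0 : m%:R != 0 :> R by rewrite pnatr_eq0 -lt0n.
have n_neq0 : n%:R != 0 :> R by rewrite pnatr_eq0 -lt0n.
have -> : Ebatch m (fun B => Gavg G s B theta) =
    'C(n, m)%:R^-1 * (m%:R^-1 * ('C(n.-1, m.-1)%:R * \sum_i G (s i) theta)).
  congr (_ * _); rewrite (eq_bigr (fun B : {set 'I_n} =>
    m%:R^-1 * \sum_(i in B) G (s i) theta)); last by move=> B /eqP <-.
  rewrite -mulr_sumr; congr (_ * _).
  rewrite (exchange_big_dep xpredT)//= mulr_sumr; apply: eq_bigr => i _.
  by rewrite sumr_const -(card_draws_mem i) cardsE mulr_natl.
have bin : n%:R * 'C(n.-1, m.-1)%:R = m%:R * 'C(n, m)%:R :> R.
  by rewrite -!natrM mul_bin_diag prednK.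
rewrite /Gavg cardsT card_ord; under [in RHS]eq_bigl do rewrite inE.
have -> : 'C(n.-1, m.-1)%:R = m%:R * 'C(n, m)%:R / n%:R :> R.
  by rewrite -bin mulrC mulKf.
by field; rewrite n_neq0 m_neq0 bin_neq0.
Qed.

Lemma batch_exists : exists B : {set 'I_n}, #|B| = m.
Proof.
have : (0 < #|[set B : {set 'I_n} | #|B| == m]%SET|)%N.
  by rewrite card_draws card_ord bin_gt0; case/andP: m_n.
by case/card_gt0P => B; rewrite inE => /eqP; exists B.
Qed.

End Batches.

(** * Dependence of the iterates on the batches, and expectations over them *)

Section Iterates.
Context {R : realType} {d n : nat} {Z : Type}.
Local Notation V := 'rV[R]_d.
Variables (G : Z -> V -> R) (s : 'I_n -> Z) (m : nat) (Psi : V -> R).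
Variables (alpha : R) (theta0 : V).
Hypothesis m_n : (0 < m <= n)%N.
Implicit Types (B : {set 'I_n}) (theta : V) (bs : nat -> {set 'I_n}).
Local Notation iter := (iterate G s Psi alpha theta0).

(** The successor case of [iterate] with the batch as an argument, so that the last batch can be
    averaged separately. *)
Definition sgd_step theta B : V :=
  theta - alpha *: egrad (conjugate Psi) (dGavg G s B theta).

Lemma eq_iterate bs bs' k : (forall i, (i < k)%N -> bs i = bs' i) ->
  iter bs k = iter bs' k.
Proof.
elim: k => [//|k IHk] eq_bs.
have iter_eq : iter bs k = iter bs' k by apply: IHk => i ik; exact/eq_bs/ltnW.
have bs_eq : bs k = bs' k by exact: eq_bs.
by rewrite [LHS]/= [RHS]/= iter_eq bs_eq.
Qed.

(** Past index [k] the default [set0] has the wrong size for a run; padding with a batch of size [m]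
    leaves the [k]-th iterate unchanged. *)
Lemma iterate_reachable (P : V -> Prop) k (w : k.-tuple {set 'I_n}) :
  (forall bs, run m bs -> P (iter bs k)) ->
  all (fun B : {set 'I_n} => #|B| == m) w -> P (iter (nth finset.set0 w) k).
Proof.
move=> Prun /all_nthP w_m; have [B0 B0m] := batch_exists _ m_n.
rewrite (eq_iterate _ (fun i => if (i < k)%N then nth finset.set0 w i else B0)).
  by apply: Prun => i; case: ifP => // ik; apply/eqP/w_m; rewrite size_tuple.
by move=> i ->.
Qed.

(** The [k]-th iterate ignores the batch at index [k], which can thus be replaced by [B]. *)
Lemma iterate_branch (P : V -> {set 'I_n} -> Prop) bs k B :
  (forall bs', run m bs' -> P (iter bs' k) (bs' k)) ->
  run m bs -> #|B| = m -> P (iter bs k) B.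
Proof.
move=> Prun bs_m B_m; pose bs' i := if i == k then B else bs i.
have := Prun bs'; rewrite /bs' eqxx (eq_iterate _ bs) => [|i ik].
  by apply => i; case: ifP.
by rewrite ltn_eqF.
Qed.

Local Notation Eiter := (Eiterate G s m Psi alpha theta0).

Lemma Eiterate0 (F : V -> R) : Eiter 0 F = F theta0.
Proof.
rewrite /Eiterate expn0 invr1 mul1r (big_pred1 [tuple])// => w.
by rewrite (tuple0 w).
Qed.

(** Splitting off the last batch by [rcons] conditions on the first [k] batches. *)
Lemma EiterateS k (F : V -> R) :
  Eiter k.+1 F =
  Eiter k (fun theta => Ebatch m (fun B => F (sgd_step theta B))).
Proof.
rewrite /Eiterate /Ebatch -mulr_sumr mulrA -invfM -natrM -expnSr.
congr (_ * _); rewrite pair_big_dep/=.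
pose h (p : k.-tuple {set 'I_n} * {set 'I_n}) : k.+1.-tuple {set 'I_n} :=
  [tuple of rcons p.1 p.2].
have h_bij : bijective h.
  apply: inj_card_bij => [[w B] [w' B'] /(congr1 val)/= /rcons_inj[]|].
    by move=> /val_inj -> ->.
  by rewrite card_prod !card_tuple expnSr.
rewrite (reindex h)/=; last exact: onW_bij.
apply: eq_big => [[w B]|[w B] _]; first by rewrite all_rcons andbC.
rewrite /h/= nth_rcons size_tuple ltnn eqxx /sgd_step.
rewrite (eq_iterate _ (nth finset.set0 w))// => i ik.
by rewrite nth_rcons size_tuple ik.
Qed.

Lemma Eiterate_le k (F F' : V -> R) :
  (forall bs, run m bs -> F (iter bs k) <= F' (iter bs k)) ->
  Eiter k F <= Eiter k F'.
Proof.
move=> leF; rewrite /Eiterate ler_wpM2l ?invr_ge0//; apply: ler_sum => w.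
exact: (iterate_reachable (fun theta => F theta <= F' theta)).
Qed.

Lemma Eiterate_cst k (c : R) : Eiter k (fun=> c) = c.
Proof.
elim: k => [|k IHk]; first by rewrite Eiterate0.
rewrite EiterateS -[RHS]IHk; congr (Eiter k _); apply/funext => theta.
exact: Ebatch_cst.
Qed.

Lemma Eiterate_affine k (F : V -> R) (a c : R) :
  Eiter k (fun theta => a * F theta + c) = a * Eiter k F + c.
Proof.
rewrite -[in RHS](Eiterate_cst k c) /Eiterate big_split/= mulrDr -mulr_sumr.
by rewrite mulrCA.
Qed.

End Iterates.

(** * Iteration counts at learning rate 1 *)

Section Convergence.
Context {R : realType} {d n : nat} {Z : Type}.
Local Notation V := 'rV[R]_d.
Variables (G : Z -> V -> R) (s : 'I_n -> Z) (m : nat) (Psi : V -> R).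
Variables (theta0 : V) (M : R).
Hypothesis m_n : (0 < m <= n)%N.
Hypothesis smooth : forall z, H_smooth Psi (G z) (grad (G z)).
Hypothesis bounded : has_lbound (range (Gavg G s [set: 'I_n]%SET)).
Hypothesis domain : forall bs k, run m bs ->
  (edom (conjugate Psi))° (dGavg G s (bs k) (iterate G s Psi 1 theta0 bs k)).
Hypothesis corr : correlation_factor G s m Psi 1 theta0 = M%:E.
Implicit Types (B : {set 'I_n}) (theta : V) (bs : nat -> {set 'I_n}).
Local Notation iter := (iterate G s Psi 1 theta0).
Local Notation Gs := (Gavg G s [set: 'I_n]%SET).
Local Notation Gs_min := (Gstar G s [set: 'I_n]%SET).
Local Notation step := (sgd_step G s Psi 1).

Let m_gt0 : 0 < m%:R :> R.
Proof. by rewrite ltr0n; case/andP: m_n. Qed.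

Let mn : m%:R <= n%:R :> R.
Proof. by rewrite ler_nat; case/andP: m_n. Qed.

Let n_gt0 : 0 < n%:R :> R.
Proof. exact: lt_le_trans m_gt0 mn. Qed.

Lemma sample_exists : inhabited Z.
Proof.
have [B0 B0m] := batch_exists _ m_n.
have /card_gt0P[i _] : (0 < #|B0|)%N by rewrite B0m; case/andP: m_n.
exact: inhabits (s i).
Qed.

Lemma Gstar_le theta : Gs_min <= Gs theta.
Proof. by apply: ge_inf => //; exists theta. Qed.

Lemma sgd_descent bs k : run m bs ->
  conjugate Psi (dGavg G s (bs k) (iter bs k)) \is a fin_num /\
  n%:R * Gs (step (iter bs k) (bs k)) <= n%:R * Gs (iter bs k)
    - m%:R * fine (conjugate Psi (dGavg G s (bs k) (iter bs k)))
    + (n%:R - m%:R) * M.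
Proof.
move=> bs_m; have dom := domain bs k bs_m.
have corrM : Gavg G s (~: bs k) (step (iter bs k) (bs k))
    - Gavg G s (~: bs k) (iter bs k) <= M.
  rewrite -lee_fin -corr; apply: ereal_sup_ubound.
  by exists bs, k; split.
have [z] := sample_exists; have [ePsi _] := smooth z.
have card_gt0 : (0 < #|bs k|)%N by rewrite bs_m; case/andP: m_n.
set theta := iter bs k in dom corrM *.
have [fin desc] :=
  generalized_descent _ _ _ theta ePsi
    (Gavg_smooth G s _ _ smooth card_gt0) dom.
split=> //; rewrite !(Gavg_split G s (bs k)) bs_m.
move: desc corrM; rewrite -/(step theta (bs k)).
move: (step _ _) (fine _) => theta' c desc corrM.
have : m%:R * Gavg G s (bs k) theta' <= m%:R * (Gavg G s (bs k) theta - c).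
  by rewrite ler_pM2l.
have : (n%:R - m%:R) * (Gavg G s (~: bs k) theta' - Gavg G s (~: bs k) theta)
    <= (n%:R - m%:R) * M by rewrite ler_wpM2l// subr_ge0.
lra.
Qed.

Lemma sgd_budget bs (e : R) : run m bs ->
  (n%:R - m%:R) * M < m%:R * e ->
  exists2 k, affordable k ((1 + (Gs theta0 - Gs_min))
                           * (n%:R / (m%:R * e - (n%:R - m%:R) * M))) &
    (conjugate Psi (dGavg G s (bs k) (iter bs k)) <= e%:E)%E.
Proof.
move=> bs_m; rewrite -subr_gt0; set D := _ - _ => D_gt0.
set b := _ * _; have := Gstar_le theta0; rewrite -subr_ge0.
set Delta := _ - _ in b *; move=> Delta_ge0.
have b_ge0 : 0 <= b.
  apply: mulr_ge0; first exact: addr_ge0 ler01 Delta_ge0.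
  exact: divr_ge0 (ltW n_gt0) (ltW D_gt0).
(* If all iterates with indices 0 to [K] miss the target, [n * Gs] loses more than [D] in each of
   [K.+1] steps, hence falls below [n * Gs_min]. *)
pose K := `|Num.ceil b|%N.
have KE : K%:Z = Num.ceil b.
  by rewrite /K gez0_abs// ceil_ge0 (lt_le_trans _ b_ge0)// ltrN10.
apply: contrapT => no_hit.
have above k : (k <= K)%N ->
    e < fine (conjugate Psi (dGavg G s (bs k) (iter bs k))).
  move=> kK; rewrite ltNge; apply/negP => le_e; apply: no_hit; exists k.
    by rewrite /affordable -KE lez_nat.
  by have [fin _] := sgd_descent bs k bs_m; rewrite -(fineK fin) lee_fin.
have decrease k : (k <= K.+1)%N ->
    n%:R * Gs (iter bs k) <= n%:R * Gs theta0 - k%:R * D.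
  elim: k => [_|k IHk kK]; first by rewrite mul0r subr0.
  have [_] := sgd_descent bs k bs_m.
  rewrite -[iter bs k.+1]/(step (iter bs k) (bs k)).
  have := IHk (ltnW kK); have := above k kK; rewrite -(ltr_pM2l m_gt0).
  by move: (fine _) => c; rewrite /D -natr1; lra.
have := decrease K.+1 (leqnn _); have := Gstar_le (iter bs K.+1).
rewrite -(ler_pM2l n_gt0) -natr1.
have : b <= K%:R by rewrite -[K%:R]/(K%:Z%:~R) KE ceil_ge.
rewrite /b mulrA ler_pdivrMr// /Delta; move: (Gs (iter bs _)) => g.
have : 0 <= n%:R :> R by exact: ltW.
lra.
Qed.

Lemma max_criterion_gap (psi : V -> R) (eps theta : V) :
  (forall z, H_convex psi (G z) (grad (G z))) ->
  (exists N, radial N Psi /\ radial N psi) ->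
  conjugate Psi eps \is a fin_num -> max_criterion G s m Psi eps theta ->
  ((Gs theta - Gs_min)%:E
   <= conjugate psi eps - (model_capacity_risk G s m)%:E)%E.
Proof.
move=> cvx [N [PsiN psiN]] fin crit.
have [z] := sample_exists; have [ePsi _] := smooth z.
have [epsi _] := cvx z.
have gap B : #|B| = m ->
    ((Gavg G s B theta - Gstar G s B)%:E <= conjugate psi eps)%E.
  move=> B_m; have := crit B B_m.
  move=> /(conjugate_radial_mono _ _ _ _ _ ePsi PsiN psiN fin).
  apply: le_trans.
  apply: suboptimality_le_conjugate => //; apply: Gavg_convex => //.
  by rewrite B_m; case/andP: m_n.
move: gap (conjugate_ltNy psi eps); case: conjugate => [c| |] gap// _;
  last exact: leey.
rewrite -EFinB lee_fin /model_capacity_risk -(Ebatch_Gavg G s _ m_n theta).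
(* The factor 1 matches the shape of [Ebatch_linear]. *)
suff : Ebatch m (fun B => Gavg G s B theta) <= 1 * Ebatch m (Gstar G s) + c.
  lra.
rewrite -[X in _ <= _ + X](Ebatch_cst (n := n) m m_n c) -Ebatch_linear.
apply: Ebatch_le => B B_m.
by have := gap B B_m; rewrite lee_fin mul1r lerBlDl.
Qed.

(** * Linear convergence in expectation *)

Section Linear.
Variables (psi : V -> R) (t b : R).
Hypothesis cvx : forall B, #|B| = m -> H_convex psi (Gavg G s B) (dGavg G s B).
Hypothesis t01 : 0 < t < 1.
Hypothesis Psi_psi : forall mu,
  (t%:E * conjugate psi mu + b%:E <= conjugate Psi mu)%E.

Let q := 1 - m%:R * t / n%:R.

(** Chosen so that [(1 - q) * floor] equals the constant error of one step,
    [(- m * b + (n - m) * M) / n]. *)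
Let floor := - b / t + (n%:R - m%:R) / (t * m%:R) * M.

Lemma rate_itv : 0 < q < 1.
Proof.
have t_gt0 : 0 < t by case/andP: t01.
rewrite /q subr_gt0 gtrBl ltr_pdivrMr// mul1r divr_gt0 ?mulr_gt0// andbT.
apply: lt_le_trans mn; rewrite gtr_pMr//; by case/andP: t01.
Qed.

(** [Psi_psi] and convexity bound the decrease along [B] below by an affine function of the batch
    gap; averaging over [B] turns the batch values back into [Gs]. *)
Lemma sgd_contraction bs k : run m bs ->
  Ebatch m (fun B => Gs (step (iter bs k) B)) <=
  q * Gs (iter bs k) + (1 - q) * (Ebatch m (Gstar G s) + floor).
Proof.
move=> bs_m; set theta := iter bs k; pose a := m%:R * t / n%:R.
have t_gt0 : 0 < t by case/andP: t01.
have step_le B : #|B| = m -> Gs (step theta B) <=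
    - a * Gavg G s B theta + (a * Gstar G s B + (Gs theta + a * floor)).
  move=> B_m.
  have [fin desc] := iterate_branch G s m Psi 1 theta0
    (fun theta B => conjugate Psi (dGavg G s B theta) \is a fin_num /\
       n%:R * Gs (step theta B) <= n%:R * Gs theta
       - m%:R * fine (conjugate Psi (dGavg G s B theta)) + (n%:R - m%:R) * M)
    bs k B (fun bs' => sgd_descent bs' k) bs_m B_m.
  have [epsi cvxB] := cvx B B_m.
  have sub := suboptimality_le_conjugate _ _ _ theta epsi cvxB.
  have lower : t * (Gavg G s B theta - Gstar G s B) + b <=
      fine (conjugate Psi (dGavg G s B theta)).
    rewrite -lee_fin fineK// EFinD EFinM.
    apply: le_trans (Psi_psi _); rewrite leeD2r// lee_wpmul2l// lee_fin.
    exact: ltW.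
  have : m%:R * (t * (Gavg G s B theta - Gstar G s B) + b) <=
      m%:R * fine (conjugate Psi (dGavg G s B theta)) by rewrite ler_pM2l.
  move: desc; rewrite -/theta.
  have nfloor : n%:R * (a * floor) = - m%:R * b + (n%:R - m%:R) * M.
    by rewrite /a /floor; field; rewrite !gt_eqF.
  have na : n%:R * a = m%:R * t by rewrite /a mulrC divfK// gt_eqF.
  move: (fine _) => c desc mc; rewrite -(ler_pM2l n_gt0).
  have -> : n%:R * (- a * Gavg G s B theta
                    + (a * Gstar G s B + (Gs theta + a * floor))) =
      n%:R * Gs theta - n%:R * a * (Gavg G s B theta - Gstar G s B)
      + n%:R * (a * floor) by ring.
  by rewrite na nfloor; lra.
have -> : q * Gs theta + (1 - q) * (Ebatch m (Gstar G s) + floor) =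
    - a * Gs theta + (a * Ebatch m (Gstar G s) + (Gs theta + a * floor)).
  by rewrite /q -/a; ring.
rewrite -(Ebatch_Gavg G s _ m_n theta).
rewrite -[X in _ + (_ + X)](Ebatch_cst (n := n) m m_n).
rewrite -!Ebatch_linear; apply: Ebatch_le => B B_m.
by rewrite Ebatch_Gavg//; exact: step_le.
Qed.

Local Notation E k := (Eiterate G s m Psi 1 theta0 k Gs).
(** Offset from the fixed point of the contraction to [Gs_min]; it equals the capacity risk minus
    [floor]. *)
Let w := Gs_min - (Ebatch m (Gstar G s) + floor).

Lemma Eiterate_geometric k :
  E k - Gs_min + w <= q ^+ k * (Gs theta0 - Gs_min + w).
Proof.
elim: k => [|k IHk]; first by rewrite expr0 mul1r Eiterate0.
have [q_gt0 _] := andP rate_itv.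
have : E k.+1 <= q * E k + (1 - q) * (Ebatch m (Gstar G s) + floor).
  rewrite EiterateS -Eiterate_affine//; apply: Eiterate_le => // bs bs_m.
  exact: sgd_contraction.
move: IHk; rewrite -(ler_pM2l q_gt0) exprS mulrA /w; lra.
Qed.

Lemma Gstar_le_Eiterate k : Gs_min <= E k.
Proof.
rewrite -[leLHS](Eiterate_cst G s m Psi 1 theta0 m_n k).
by apply: Eiterate_le => // bs _; exact: Gstar_le.
Qed.

(* E k - Gs_min + w tends to 0 while staying above w. *)
Lemma offset_le0 : w <= 0.
Proof.
have [q_gt0 q_lt1] := andP rate_itv.
rewrite leNgt; apply/negP => w_gt0.
have : q ^+ k * (Gs theta0 - Gs_min + w) @[k --> \oo] --> 0.
  rewrite -[X in _ --> X](mul0r (Gs theta0 - Gs_min + w)); apply: cvgMl.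
  by apply: cvg_expr; rewrite gtr0_norm.
move=> /cvgrPdist_lt/(_ w w_gt0)[k _ /(_ k (leqnn k))] /=.
rewrite sub0r normrN => /(le_lt_trans (ler_norm _)).
by have := Eiterate_geometric k; have := Gstar_le_Eiterate k; lra.
Qed.

(** Since [w <= 0], the geometric bound is at most [q ^+ k * Delta], so it suffices to bring this
    product below [x]. *)
Lemma Eiterate_budget (x : R) : 0 < x <= expR (- 1) ->
  exists2 k, affordable k
      ((1 + (Gs theta0 - Gs_min)) * (- (ln q)^-1 * ln x^-1)) &
    E k - Gs_min <= x - w.
Proof.
move=> /andP[x_gt0 x_le]; have [q_gt0 q_lt1] := andP rate_itv.
have := Gstar_le theta0; rewrite -subr_ge0.
set Delta := _ - _ => Delta_ge0; set beta := _ * _.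
have lnq_lt0 : ln q < 0 by rewrite ln_lt0// q_gt0.
have L_ge1 : 1 <= ln x^-1.
  by rewrite lnV// lerNr -[- 1]expRK ler_ln ?posrE ?expR_gt0.
have beta_ge0 : 0 <= beta.
  apply: mulr_ge0; first exact: addr_ge0 ler01 Delta_ge0.
  apply: mulr_ge0; last exact: le_trans ler01 L_ge1.
  by rewrite oppr_ge0 invr_le0 ltW.
pose k := `|Num.ceil beta|%N.
have kE : k%:Z = Num.ceil beta.
  by rewrite /k gez0_abs// ceil_ge0 (lt_le_trans _ beta_ge0)// ltrN10.
exists k; first by rewrite /affordable kE.
have beta_k : beta <= k%:R by rewrite -[k%:R]/(k%:Z%:~R) kE ceil_ge.
clearbody k; have geom := Eiterate_geometric k.
have qk_ge0 : 0 <= q ^+ k by rewrite exprn_ge0// ltW.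
(* In [(1 + Delta) * ln x^-1] the summand 1 produces the factor [x]; the other produces
   [expR (- Delta)] because [ln x^-1 >= 1]. That exponential later absorbs [Delta]. *)
have qk_le : q ^+ k <= x * expR (- Delta).
  have -> : q ^+ k = expR (k%:R * ln q).
    by rewrite mulrC expRM_natr lnK.
  have -> : x = expR (- ln x^-1) by rewrite lnV// opprK lnK.
  rewrite -expRD ler_expR.
  have : k%:R * ln q <= beta * ln q by rewrite ler_nM2r.
  have -> : beta * ln q = - (1 + Delta) * ln x^-1.
    by rewrite /beta; field; rewrite lt_eqF.
  have : Delta * 1 <= Delta * ln x^-1 by rewrite ler_wpM2l.
  lra.
suff : q ^+ k * (Delta + w) <= x by move: geom; rewrite -/Delta; lra.
apply: (@le_trans _ _ (q ^+ k * Delta)).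
  by rewrite ler_wpM2l// gerDl offset_le0.
apply: (le_trans (ler_wpM2r Delta_ge0 qk_le)).
rewrite -mulrA ler_piMr ?(ltW x_gt0)// expRN mulrC ler_pdivrMr ?expR_gt0// mul1r.
by apply: le_trans (expR_ge1Dx _); rewrite lerDr.
Qed.

End Linear.
End Convergence.

(* C : the hidden constant, a function of the initial suboptimality only;
   x0 : the range of psi^*(eps) - psi^*(0) on which the O of part (3) holds. *)
Theorem theorem20 (R : realType) :
  exists (C : R -> R) (x0 : R), 0 < x0 /\
  forall (d n m : nat) (Z : Type) (G : Z -> 'rV[R]_d -> R) (s : 'I_n -> Z)
    (Psi : 'rV[R]_d -> R) (theta0 : 'rV[R]_d) (M : R),
  (0 < m <= n)%N ->
  (forall z, H_smooth Psi (G z) (grad (G z))) ->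
  (forall B : {set 'I_n}, #|B| = m \/ B = [set: 'I_n]%SET ->
     has_lbound (range (Gavg G s B))) ->
  (forall bs k, run m bs ->
     (edom (conjugate Psi))°
       (dGavg G s (bs k) (iterate G s Psi 1 theta0 bs k))) ->
  correlation_factor G s m Psi 1 theta0 = M%:E ->
  let theta := iterate G s Psi 1 theta0 in
  let Gs := Gavg G s [set: 'I_n]%SET in
  let Gs_min := Gstar G s [set: 'I_n]%SET in
  let c := C (Gs theta0 - Gs_min) in
  let RG := model_capacity_risk G s m in
  let budget (eps : 'rV[R]_d) : R :=
    n%:R / (m%:R * fine (conjugate Psi eps) - (n%:R - m%:R) * M) in
  let admissible (eps : 'rV[R]_d) : Prop :=
    conjugate Psi eps \is a fin_num /\
    (n%:R - m%:R) * M < m%:R * fine (conjugate Psi eps) in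
  (* (1) *)
  (forall eps, admissible eps -> forall bs, run m bs ->
     (exists2 k : nat, affordable k (c * budget eps) &
        (conjugate Psi (dGavg G s (bs k) (theta bs k)) <= conjugate Psi eps)%E)
     /\
     (samples_violations G s m Psi 1 theta0 eps bs ->
      exists2 k : nat, affordable k (c * budget eps) &
        max_criterion G s m Psi eps (theta bs k)))
  /\
  (* (2) *)
  (forall psi : 'rV[R]_d -> R,
     (forall z, H_convex psi (G z) (grad (G z))) ->
     (exists N, radial N Psi /\ radial N psi) ->
     forall eps, admissible eps -> forall bs, run m bs ->
     samples_violations G s m Psi 1 theta0 eps bs ->
     exists2 k : nat, affordable k (c * budget eps) &
       ((Gs (theta bs k) - Gs_min)%:E <= conjugate psi eps - RG%:E)%E)
  /\
  (* (3) *)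
  (forall (psi : 'rV[R]_d -> R) (t b : R),
     (forall B : {set 'I_n}, #|B| = m ->
        H_convex psi (Gavg G s B) (dGavg G s B) /\
        H_smooth Psi (Gavg G s B) (dGavg G s B)) ->
     0 < t < 1 ->
     (forall mu, (t%:E * conjugate psi mu + b%:E <= conjugate Psi mu)%E) ->
     let kappa : R := - (ln (1 - m%:R * t / n%:R))^-1 in
     forall eps, conjugate psi eps \is a fin_num ->
     let x : R := fine (conjugate psi eps) - fine (conjugate psi 0) in
     0 < x <= x0 ->
     exists2 k : nat, affordable k (c * (kappa * ln x^-1)) &
       let gap := Eiterate G s m Psi 1 theta0 k Gs - Gs_min in
       let target := fine (conjugate psi eps) - RG - b / t in
       gap <= target + (n%:R - m%:R) / (t * m%:R) * M /\
       (M <= 0 -> gap <= target - (n%:R - m%:R) / (t * m%:R) * M)).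
Proof.
(* The threshold [expR (- 1)] ensures [ln x^-1 >= 1], as [Eiterate_budget] requires. *)
exists (fun Delta => 1 + Delta), (expR (- 1)); split; first exact: expR_gt0.
move=> d n m Z G s Psi theta0 M m_n smooth bounded domain corr.
move=> theta Gs Gs_min c RG budget admissible.
have bounded_s : has_lbound (range Gs) by apply: bounded; right.
have hit eps bs : admissible eps -> run m bs ->
    exists2 k, affordable k (c * budget eps) &
      (conjugate Psi (dGavg G s (bs k) (theta bs k)) <= conjugate Psi eps)%E.
  move=> [fin D_gt0] bs_m.
  have [k k_aff] := sgd_budget G s m Psi theta0 M m_n smooth bounded_s domain
    corr bs (fine (conjugate Psi eps)) bs_m D_gt0.
  by rewrite fineK//; exists k.
have hit_max eps bs : admissible eps -> run m bs ->
    samples_violations G s m Psi 1 theta0 eps bs ->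
    exists2 k, affordable k (c * budget eps) &
      max_criterion G s m Psi eps (theta bs k).
  move=> adm bs_m viol; have [k k_aff le_eps] := hit eps bs adm bs_m.
  (* Were the criterion to fail at this iterate, the sampled batch would violate it too, against
     [le_eps]. *)
  exists k => //; apply: contrapT => /viol.
  by rewrite ltNge le_eps.
split; [|split].
- by move=> eps adm bs bs_m; split; [exact: hit|exact: hit_max].
- move=> psi cvx radials eps adm bs bs_m viol.
  have [k k_aff crit] := hit_max eps bs adm bs_m viol.
  exists k => //; apply: (max_criterion_gap G s m Psi m_n smooth) crit => //.
  by case: adm.
move=> psi t b cvx_smooth t01 Psi_psi kappa eps fin x x_itv.
have cvx (B : {set 'I_n}) : #|B| = m -> H_convex psi (Gavg G s B) (dGavg G s B).
  by move=> /cvx_smooth[].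
have [k k_aff gap] := Eiterate_budget G s m Psi theta0 M m_n smooth bounded_s
  domain corr psi t b cvx t01 Psi_psi x x_itv.
exists k => // E_gap target.
(* The conjugate at 0 is [- psi 0], and [psi 0 <= 0] because a Bregman expression vanishes on the
   diagonal. *)
have x_le : x <= fine (conjugate psi eps).
  have [B0 B0_m] := batch_exists _ m_n; have [epsi cvx0] := cvx B0 B0_m.
  rewrite /x (conjugate0 _ epsi)/= opprK gerDl.
  by have := cvx0 0 0; rewrite /bregman !subrr dot0r subr0.
(* The recursion yields the [M] term with a plus sign; when [M <= 0] this bound implies the one with
   a minus sign. *)
suff main : E_gap <= target + (n%:R - m%:R) / (t * m%:R) * M.
  split=> // M_le0; apply: (le_trans main).
  have : (n%:R - m%:R) / (t * m%:R) * M <= 0.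
    have /andP[t_gt0 _] := t01; have /andP[_ mn] := m_n.
    by rewrite mulr_ge0_le0// divr_ge0 ?subr_ge0 ?ler_nat ?mulr_ge0 ?(ltW t_gt0).
  lra.
apply: (le_trans gap); rewrite /target /RG /model_capacity_risk -/Gs_min.
lra.
Qed.
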